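(* Let $\mathbb{H}$ be a real or complex Hilbert space, let $A\in\mathbb{B}(\mathbb{H})$ be a nonzero positive operator, and let $\mathbb{A}=\begin{pmatrix}A&0\\0&A\end{pmatrix}\in\mathbb{B}(\mathbb{H}\oplus\mathbb{H})$. Let $M,N\in\mathbb{B}(\mathbb{H})$ be such that $T=\begin{pmatrix}M&0\\0&N\end{pmatrix}\in\mathbb{B}_{\mathbb{A}}(\mathbb{H}\oplus\mathbb{H})$ and $\|T\|_{\mathbb{A}}\neq 0$. Then: (i) If $\|M\|_A>\|N\|_A$, then $T$ is $\mathbb{A}$-smooth if and only if $M$ is $A$-smooth. (ii) If $\|M\|_A<\|N\|_A$, then $T$ is $\mathbb{A}$-smooth if and only if $N$ is $A$-smooth. (iii) If $\|M\|_A=\|N\|_A$, then $T$ is not $\mathbb{A}$-smooth.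
   Context: The following notions are defined for a nonzero positive operator $A$ on a Hilbert space $\mathbb{H}$, and are applied also to the positive operator $\mathbb{A}$ on $\mathbb{H}\oplus\mathbb{H}$. $\mathbb{B}(\mathbb{H})$ is the set of bounded linear operators on $(\mathbb{H},\langle\cdot,\cdot\rangle)$. A positive operator $A$ is a self-adjoint operator with $\langle Ax,x\rangle\ge 0$ for all $x$. It induces the semi-inner product $\langle x,y\rangle_A=\langle Ax,y\rangle$ and the semi-norm $\|x\|_A=\sqrt{\langle x,x\rangle_A}$. $\mathbb{B}_{A^{1/2}}(\mathbb{H})$ is the set of $A$-bounded operators, i.e. those $T\in\mathbb{B}(\mathbb{H})$ for which there is $c>0$ with $\|Tx\|_A\le c\|x\|_A$ for all $x\in\mathbb{H}$; for such $T$, $\|T\|_A=\sup\{\|Tx\|_A:\|x\|_A=1\}$. $\mathbb{B}_A(\mathbb{H})=\{T\in\mathbb{B}(\mathbb{H}):R(T^*A)\subset R(A)\}$, where $R(\cdot)$ is the range; it is known that $\mathbb{B}_A(\mathbb{H})\subset\mathbb{B}_{A^{1/2}}(\mathbb{H})$. If $T=\begin{pmatrix}M&0\\0&N\end{pmatrix}\in\mathbb{B}_{\mathbb{A}}(\mathbb{H}\oplus\mathbb{H})$ then $M,N\in\mathbb{B}_A(\mathbb{H})$. On $\mathbb{H}\oplus\mathbb{H}$, $\langle x,y\rangle_{\mathbb{A}}=\langle x_1,y_1\rangle_A+\langle x_2,y_2\rangle_A$ for $x=(x_1,x_2)$, $y=(y_1,y_2)$. $T\perp_A^B S$ means $\|T+\lambda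 S\|_A\ge\|T\|_A$ for all scalars $\lambda$. An operator $T\in\mathbb{B}_{A^{1/2}}(\mathbb{H})$ with $\|T\|_A\neq 0$ is called $A$-smooth if for all $S_1,S_2\in\mathbb{B}_{A^{1/2}}(\mathbb{H})$, $T\perp_A^B S_1$ and $T\perp_A^B S_2$ imply $T\perp_A^B S_1+S_2$. *)

(* Defs.v *)
From HB Require Import structures.
From mathcomp Require Import all_boot all_order all_algebra.
From mathcomp Require Import sesquilinear complex.
From mathcomp Require Import boolp classical_sets functions reals topology.
From mathcomp Require Import normedtype ring lra.

Set Implicit Arguments.
Unset Strict Implicit.
Unset Printing Implicit Defensive.

Import Order.TTheory GRing.Theory Num.Theory numFieldNormedType.Exports.

Local Open Scope classical_set_scope.
Local Open Scope complex_scope.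
Local Open Scope ring_scope.

Variant scalar_kind := RealScalars | ComplexScalars.

Definition scalar (R : realType) (k : scalar_kind) : numFieldType :=
  match k with RealScalars => R | ComplexScalars => R[i] end.

Definition sconj (R : realType) (k : scalar_kind) : scalar R k -> scalar R k :=
  match k return scalar R k -> scalar R k with
  | RealScalars => idfun
  | ComplexScalars => fun z : R[i] => Num.conj z
  end.

Definition sre (R : realType) (k : scalar_kind) : scalar R k -> R :=
  match k return scalar R k -> R with
  | RealScalars => idfun
  | ComplexScalars => fun z : R[i] => complex.Re z
  end.

Definition of_real (R : realType) (k : scalar_kind) : R -> scalar R k :=
  match k return R -> scalar R k with
  | RealScalars => idfun
  | ComplexScalars => fun x => x%:C
  end.
Arguments of_real {R} k.

Section ScalarTheory.
Context {R : realType} {k : scalar_kind}.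
Implicit Types (a b : R) (z w : scalar R k).

Fact sconj_is_zmod_morphism : zmod_morphism (@sconj R k).
Proof. by case: k => // z w; exact: raddfB. Qed.

Fact sconj_is_monoid_morphism : monoid_morphism (@sconj R k).
Proof. by case: k; split=> //= [|z w]; rewrite ?rmorph1 ?rmorphM. Qed.

HB.instance Definition _ := GRing.isZmodMorphism.Build
  (scalar R k) (scalar R k) (@sconj R k) sconj_is_zmod_morphism.
HB.instance Definition _ := GRing.isMonoidMorphism.Build
  (scalar R k) (scalar R k) (@sconj R k) sconj_is_monoid_morphism.

Lemma sreD z w : sre (z + w) = sre z + sre w.
Proof. by case: k z w => //= z w; rewrite raddfD. Qed.

Lemma of_realK a : sre (of_real k a) = a.
Proof. by case: k. Qed.

Lemma of_realM a b : of_real k (a * b) = of_real k a * of_real k b.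
Proof. by case: k => //=; rewrite rmorphM. Qed.

Lemma of_realD a b : of_real k (a + b) = of_real k a + of_real k b.
Proof. by case: k => //=; rewrite rmorphD. Qed.

Lemma of_real_le a b : (of_real k a <= of_real k b) = (a <= b).
Proof. by case: k => //=; rewrite lecR. Qed.

Lemma of_real_lt a b : (of_real k a < of_real k b) = (a < b).
Proof. by case: k => //=; rewrite ltcR. Qed.

Lemma of_real0 : of_real k (0 : R) = 0.
Proof. by case: k. Qed.

Lemma sreK z : 0 <= z -> of_real k (sre z) = z.
Proof.
by case: k z => //= -[x y]; rewrite lecE /= => /andP[/eqP -> _].
Qed.

Lemma sre_ge0 z : 0 <= z -> 0 <= sre z.
Proof. by move=> z0; rewrite -of_real_le sreK// of_real0. Qed.

End ScalarTheory.

(* The inner product is linear in its first argument and, as {dot _ for _}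
   requires, semilinear in the second one and hermitian. *)
HB.mixin Record isHilbert (R : realType) (k : scalar_kind) (H : Type)
    & CompleteNormedModule (scalar R k) H := {
  dotp_form : {dot H for @sconj R k};
  dotp_norm : forall x : H, dotp_form x x = `|x| ^+ 2
}.

#[short(type="hilbertType")]
HB.structure Definition Hilbert (R : realType) (k : scalar_kind) :=
  {H of CompleteNormedModule (scalar R k) H & isHilbert R k H}.

Definition dotp (R : realType) (k : scalar_kind) (H : hilbertType R k)
  (x y : H) : scalar R k := @dotp_form R k H x y.

(* The library norms products by the maximum; the alias carries the norm of
   the orthogonal direct sum instead. *)
Definition hsum (R : realType) (k : scalar_kind) (H1 H2 : hilbertType R k)
  : Type := (H1 * H2)%type.

Section DirectSum.
Context (R : realType) (k : scalar_kind) (H1 H2 : hilbertType R k).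
Local Notation K := (scalar R k).
Local Notation hsum := (hsum H1 H2).

HB.instance Definition _ := GRing.Lmodule.copy hsum (H1 * H2)%type.

Definition hsum_norm (x : hsum) : K :=
  of_real k (Num.sqrt (sre `|x.1| ^+ 2 + sre `|x.2| ^+ 2)).

Lemma minkowski2 (a b c d : R) : 0 <= a -> 0 <= b -> 0 <= c -> 0 <= d ->
  Num.sqrt ((a + c) ^+ 2 + (b + d) ^+ 2) <=
  Num.sqrt (a ^+ 2 + b ^+ 2) + Num.sqrt (c ^+ 2 + d ^+ 2).
Proof.
move=> a0 b0 c0 d0.
have s0 (x y : R) : 0 <= x ^+ 2 + y ^+ 2 by rewrite addr_ge0 ?sqr_ge0.
rewrite -[leRHS]ger0_norm ?addr_ge0 ?sqrtr_ge0// -sqrtr_sqr ler_sqrt ?sqr_ge0//.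
rewrite [leRHS]sqrrD !sqr_sqrtr// -sqrtrM//.
have : a * c + b * d <=
    Num.sqrt ((a ^+ 2 + b ^+ 2) * (c ^+ 2 + d ^+ 2)).
  rewrite -[leLHS]ger0_norm ?addr_ge0 ?mulr_ge0//.
  rewrite -sqrtr_sqr ler_sqrt ?mulr_ge0// -subr_ge0.
  have -> : (a ^+ 2 + b ^+ 2) * (c ^+ 2 + d ^+ 2) - (a * c + b * d) ^+ 2 =
      (a * d - b * c) ^+ 2 by ring.
  exact: sqr_ge0.
by lra.
Qed.

Lemma hsum_normD x y : hsum_norm (x + y) <= hsum_norm x + hsum_norm y.
Proof.
rewrite /hsum_norm -of_realD of_real_le.
apply: le_trans (minkowski2 _ _ _ _); last 4 first.
- exact/sre_ge0/normr_ge0.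
- exact/sre_ge0/normr_ge0.
- exact/sre_ge0/normr_ge0.
- exact/sre_ge0/normr_ge0.
have le_sre (V : normedModType K) (u v : V) :
    sre `|u + v| ^+ 2 <= (sre `|u| + sre `|v|) ^+ 2.
  have le_uv : sre `|u + v| <= sre `|u| + sre `|v|.
    by rewrite -(of_real_le (k := k)) of_realD !sreK// ler_normD.
  by apply: lerXn2r; rewrite // nnegrE ?addr_ge0 ?sre_ge0.
rewrite ler_sqrt ?addr_ge0 ?sqr_ge0//.
by apply: lerD; exact: le_sre.
Qed.

Lemma hsum_normZ (l : K) x : hsum_norm (l *: x) = `|l| * hsum_norm x.
Proof.
rewrite /hsum_norm -[`|l| in RHS]sreK// -of_realM; congr of_real.
have sreZ (V : normedModType K) (u : V) :
    sre `|l *: u| = sre `|l| * sre `|u|.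
  by rewrite -[LHS](of_realK (k:=k)) normrZ -[RHS](of_realK (k:=k)) of_realM !sreK ?mulr_ge0.
rewrite !sreZ !exprMn -mulrDr sqrtrM ?sqr_ge0// sqrtr_sqr ger0_norm//.
exact: sre_ge0.
Qed.

Lemma hsum_norm_ge1 (x : hsum) : `|x.1| <= hsum_norm x.
Proof.
rewrite -[leLHS]sreK// of_real_le -[leLHS]ger0_norm ?sre_ge0//.
by rewrite -sqrtr_sqr ler_sqrt ?addr_ge0 ?sqr_ge0// lerDl sqr_ge0.
Qed.

Lemma hsum_norm_ge2 (x : hsum) : `|x.2| <= hsum_norm x.
Proof.
rewrite -[leLHS]sreK// of_real_le -[leLHS]ger0_norm ?sre_ge0//.
by rewrite -sqrtr_sqr ler_sqrt ?addr_ge0 ?sqr_ge0// lerDr sqr_ge0.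
Qed.

Lemma hsum_norm_le (x : hsum) : hsum_norm x <= `|x.1| + `|x.2|.
Proof.
rewrite -[X in _ <= X + _]sreK// -[X in _ <= _ + X]sreK// -of_realD of_real_le.
rewrite -[leRHS]ger0_norm ?addr_ge0 ?sre_ge0// -sqrtr_sqr.
rewrite ler_sqrt ?sqr_ge0// sqrrD -addrA lerD2l lerDr.
by rewrite mulrn_wge0// mulr_ge0// sre_ge0.
Qed.

Lemma hsum_norm0 x : hsum_norm x = 0 -> x = 0.
Proof.
move=> x0; have := hsum_norm_ge1 x; have := hsum_norm_ge2 x.
by rewrite x0 !normr_le0; case: x {x0} => x y /= /eqP -> /eqP ->.
Qed.

HB.instance Definition _ := Lmodule_isNormed.Build K hsum
  hsum_normD hsum_normZ hsum_norm0.

Lemma hsum_normE (x : hsum) : `|x| = hsum_norm x. Proof. by []. Qed.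

Lemma hsum_complete (F : set_system hsum) :
  ProperFilter F -> cauchy F -> cvg F.
Proof.
move=> FF /cauchy_ballP F_cauchy.
have cvg_proj (H : hilbertType R k) (p : hsum -> H) :
    (forall x y, `|p x - p y| <= `|x - y|) -> cvg (p @ F).
  move=> p_le; apply: cauchy_cvg; apply/cauchy_ballP => e e0.
  have [[A B] /= [FA FB] AB] := F_cauchy e e0.
  exists (p @` A, p @` B) => /=.
    by split; [apply: filterS FA | apply: filterS FB] => x ?; exists x.
  move=> [_ _] /= [[x Ax <-] [y By <-]].
  have := AB (x, y) (conj Ax By).
  rewrite -!ball_normE /=; exact: le_lt_trans.
have c1 : cvg ((fun x : hsum => x.1) @ F).
  by apply: cvg_proj => x y; exact: (hsum_norm_ge1 (x - y)).
have c2 : cvg ((fun x : hsum => x.2) @ F).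
  by apply: cvg_proj => x y; exact: (hsum_norm_ge2 (x - y)).
apply/cvg_ex.
exists ((lim ((fun x : hsum => x.1) @ F), lim ((fun x : hsum => x.2) @ F)) : hsum).
apply/cvgrPdist_lt => e e0.
have e20 : 0 < e / 2 by rewrite divr_gt0.
near=> x.
apply: le_lt_trans (hsum_norm_le _) _.
rewrite [e]splitr ltrD//=.
- by near: x; move/cvgrPdist_lt : c1; exact.
- by near: x; move/cvgrPdist_lt : c2; exact.
Unshelve. all: by end_near. Qed.

HB.instance Definition _ := Uniform_isComplete.Build hsum hsum_complete.

Definition hsum_dotp (x y : hsum) : K := dotp x.1 y.1 + dotp x.2 y.2.

Lemma hsum_dotpDl z : zmod_morphism (hsum_dotp ^~ z).
Proof. by move=> x y; rewrite /hsum_dotp /dotp !linearBl opprD addrACA. Qed.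

Lemma hsum_dotpDr z : zmod_morphism (hsum_dotp z).
Proof. by move=> x y; rewrite /hsum_dotp /dotp !linearBr opprD addrACA. Qed.

Lemma hsum_dotpZl z : scalable_for *%R (hsum_dotp ^~ z).
Proof. by move=> l x; rewrite /hsum_dotp /dotp !linearZl_LR mulrDr. Qed.

Lemma hsum_dotpZr z : scalable_for (@sconj R k \; *%R) (hsum_dotp z).
Proof. by move=> l x; rewrite /hsum_dotp /dotp !linearZr_LR /= mulrDr. Qed.

HB.instance Definition _ := isBilinear.Build K hsum hsum K _ _ hsum_dotp
  hsum_dotpDl hsum_dotpDr hsum_dotpZl hsum_dotpZr.

Lemma hsum_dotpC x y : hsum_dotp x y = (-1) ^+ false * sconj (hsum_dotp y x).
Proof.
rewrite /hsum_dotp rmorphD mul1r.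
have hC (H : hilbertType R k) (u v : H) : dotp u v = sconj (dotp v u).
  by have /= := hermC (@dotp_form R k H) u v; rewrite mul1r.
by congr (_ + _); exact: hC.
Qed.

HB.instance Definition _ := isHermitianSesquilinear.Build K hsum false
  (@sconj R k) hsum_dotp hsum_dotpC.

Lemma hsum_dotp_norm x : hsum_dotp x x = `|x| ^+ 2.
Proof.
rewrite /hsum_dotp /dotp !dotp_norm hsum_normE /hsum_norm [RHS]expr2 -of_realM -expr2.
by rewrite sqr_sqrtr ?addr_ge0 ?sqr_ge0// of_realD !expr2 !of_realM !sreK.
Qed.

Lemma hsum_dotp_gt0 x : x != 0 -> 0 < hsum_dotp x x.
Proof. by move=> x0; rewrite hsum_dotp_norm exprn_gt0 ?normr_gt0. Qed.

HB.instance Definition _ := isDotProduct.Build K hsum hsum_dotp hsum_dotp_gt0.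

HB.instance Definition _ := isHilbert.Build R k hsum hsum_dotp_norm.

Lemma dotp_hsumE (x y : hsum) : dotp x y = dotp x.1 y.1 + dotp x.2 y.2.
Proof. by []. Qed.

End DirectSum.

Section BlockDiagonal.
Context (R : realType) (k : scalar_kind) (H1 H2 : hilbertType R k).
Variables (M : {linear H1 -> H1}) (N : {linear H2 -> H2}).

Definition diag_op (x : hsum H1 H2) : hsum H1 H2 := (M x.1, N x.2).

Lemma diag_op_is_linear : linear diag_op.
Proof. by move=> a x y; rewrite /diag_op /= !linearP. Qed.

HB.instance Definition _ := GRing.isLinear.Build (scalar R k)
  (hsum H1 H2) (hsum H1 H2) _ diag_op diag_op_is_linear.

End BlockDiagonal.

Section SemiHilbert.
Context (R : realType) (k : scalar_kind) (H : hilbertType R k).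
Local Notation K := (scalar R k).
Implicit Types (A S T : {linear H -> H}) (x y : H).

Definition bounded_op T := exists c : K, forall x, `|T x| <= c * `|x|.

Definition is_adjoint T S := forall x y, dotp (T x) y = dotp x (S y).

(* Over [R[i]], [0 <= z] means that [z] is real and nonnegative. *)
Definition positive_op A :=
  [/\ bounded_op A, is_adjoint A A & forall x, 0 <= dotp (A x) x].

Definition semi_dotp A x y : K := dotp (A x) y.

(* [semi_dotp A x x] is real when [A] is positive. *)
Definition semi_norm A x : R := Num.sqrt (sre (semi_dotp A x x)).

Definition semi_bounded A T : Prop :=
  bounded_op T /\
  exists2 c : R, 0 < c & forall x, semi_norm A (T x) <= c * semi_norm A x.

(* The bounded adjoint of a bounded operator exists and is unique (Riesz). *)
Definition semi_adjointable A T : Prop :=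
  bounded_op T /\
  exists Tstar : {linear H -> H},
    [/\ bounded_op Tstar, is_adjoint T Tstar
       & range (fun x => Tstar (A x)) `<=` range A].

(* [sup] of an unbounded set is the dummy 0, so this is meaningful only for
   functions that are bounded with respect to [semi_norm A]. *)
Definition semi_opnorm A (T : H -> H) : R :=
  sup [set semi_norm A (T x) | x in [set x | semi_norm A x = 1]].

Definition semi_BJ_orthogonal A (T S : H -> H) : Prop :=
  forall l : K, semi_opnorm A T <= semi_opnorm A (fun x => T x + l *: S x).

Definition semi_smooth A T : Prop :=
  [/\ semi_bounded A T, semi_opnorm A T != 0
     & forall S1 S2, semi_bounded A S1 -> semi_bounded A S2 ->
         semi_BJ_orthogonal A T S1 -> semi_BJ_orthogonal A T S2 ->
         semi_BJ_orthogonal A T (fun x => S1 x + S2 x)].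

End SemiHilbert.

(* Main.v *)
Require Import Defs.
From HB Require Import structures.
From mathcomp Require Import all_boot all_order all_algebra.
From mathcomp Require Import sesquilinear complex.
From mathcomp Require Import boolp classical_sets functions reals topology.
From mathcomp Require Import normedtype.
From mathcomp Require Import ring lra.

Set Implicit Arguments.
Unset Strict Implicit.
Unset Printing Implicit Defensive.

Import Order.TTheory GRing.Theory Num.Theory numFieldNormedType.Exports.

Local Open Scope ring_scope.

(** Write a and b for the A-seminorms of M and N.

    If b < a, the operator T = diag(M, N) owes its seminorm a to the first
    block alone, so only the first diagonal block of a perturbation S can matter
    to first order: T is Birkhoff-James orthogonal to S exactly when M is
    orthogonal to the compression u |-> (S (u, 0)).1 (BJ_orthogonal_diag).  As
    compression is linear in S, and every operator on the first summand is the
    compression of some block diagonal operator, additivity of the relation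
    transfers in both directions, which is the first claim (semi_smooth_diag).
    The only part of the orthogonality criterion that needs an estimate is this
    one: if M + l S11 has seminorm m < a, then some T + t l S has seminorm less
    than a (compress1_perturb_lt).  By convexity the first diagonal block of
    T + t l S has seminorm at most a - t (a - m), the gain being linear in t,
    whereas the off-diagonal blocks are of size t and contribute only t ^ 2
    since the second diagonal block stays away from a.

    The second claim is the first one conjugated by the isometry exchanging the
    two summands (semi_smooth_swap).  For the third, if a = b then T is
    orthogonal to both diag(M, 0) and diag(0, N), because each leaves intact one
    block of seminorm a; but their sum is T itself, and T - T = 0
    (semi_smooth_diag_neq).

    All of this requires suprema over the A-unit sphere to be finite, that is,
    that an operator with T^* A mapping into the range of A is bounded for the
    A-seminorm (semi_adjointable_bounded).  The range inclusion gives
    |A T w| <= C |A w| by uniform boundedness.  Choosing f with A f = T^* A T,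
    the moments p n = <A f^n x, x> are log-convex along the powers of two and
    grow at most geometrically, at a rate D that does not depend on x; hence
    p 1 <= D p 0, where p 1 = |T x|_A ^ 2 and p 0 = |x|_A ^ 2.

    Both scalar fields are treated at once through the real inner product
    redot, the real part of the given one: it determines the seminorms, and the
    constants involved are real. *)

(** * Real parts of scalars and of the inner product *)

Section RealParts.
Context {R : realType} {k : scalar_kind}.
Local Notation K := (Defs.scalar R k).

Lemma sre_of_realM (t : R) (z : K) : sre (of_real k t * z) = t * sre z.
Proof. by case: k z => //= -[x y] /=; rewrite mul0r subr0. Qed.

Lemma sre_sconj (z : K) : sre (sconj z) = sre z.
Proof. by case: k z => //= -[x y]. Qed.

Lemma mul_sconj (z : K) : z * sconj z = `|z| ^+ 2.
Proof. by case: k z => [z|z] /=; rewrite ?normCK// real_normK ?num_real. Qed.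

Lemma sreB (z w : K) : sre (z - w) = sre z - sre w.
Proof. by case: k z w => //= z w; rewrite raddfB. Qed.

Lemma sre_norm_of_real (t : R) : 0 <= t -> sre `|of_real k t| = t.
Proof. by move=> t0; rewrite ger0_norm ?of_realK// -of_real0 of_real_le. Qed.

Lemma sre_le (z w : K) : 0 <= z -> 0 <= w -> (sre z <= sre w) = (z <= w).
Proof. by move=> z0 w0; rewrite -(of_real_le (k := k)) !sreK. Qed.

Lemma sre_norm_ge0 (V : normedModType K) (x : V) : 0 <= sre `|x|.
Proof. exact: sre_ge0. Qed.

End RealParts.

Section RealInnerProduct.
Context {R : realType} {k : scalar_kind} {H : hilbertType R k}.
Local Notation K := (Defs.scalar R k).
Implicit Types (x y z : H) (t : R).

Definition rnorm x : R := sre `|x|.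

Definition redot x y : R := sre (dotp x y).

Lemma rnorm_ge0 x : 0 <= rnorm x. Proof. exact: sre_norm_ge0. Qed.

Lemma redotC x y : redot x y = redot y x.
Proof.
rewrite /redot -[RHS]sre_sconj /dotp.
by have /= -> := hermC (@dotp_form R k H) x y; rewrite mul1r.
Qed.

Lemma redotDl x y z : redot (x + y) z = redot x z + redot y z.
Proof. by rewrite /redot /dotp linearDl sreD. Qed.

Lemma redotDr x y z : redot z (x + y) = redot z x + redot z y.
Proof. by rewrite /redot /dotp linearDr sreD. Qed.

Lemma redotBr x y z : redot z (x - y) = redot z x - redot z y.
Proof. by rewrite /redot /dotp linearBr sreB. Qed.

Lemma redotZl t x y : redot (of_real k t *: x) y = t * redot x y.
Proof. by rewrite /redot /dotp linearZl_LR sre_of_realM. Qed.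

Lemma redotZr t x y : redot x (of_real k t *: y) = t * redot x y.
Proof. by rewrite redotC redotZl redotC. Qed.

Lemma redot0l y : redot 0 y = 0.
Proof. by rewrite /redot /dotp linear0l -of_real0 of_realK. Qed.

Lemma redotxx x : redot x x = rnorm x ^+ 2.
Proof.
rewrite /redot /dotp dotp_norm /rnorm expr2 -{1}[`|x|]sreK//.
by rewrite sre_of_realM expr2.
Qed.

Lemma rnormZ (l : K) x : rnorm (l *: x) = sre `|l| * rnorm x.
Proof. by rewrite /rnorm normrZ -[`|l|]sreK// sre_of_realM of_realK. Qed.

Lemma ler_rnormD x y : rnorm (x + y) <= rnorm x + rnorm y.
Proof. by rewrite /rnorm -sreD sre_le ?addr_ge0// ler_normD. Qed.

Lemma rnorm_eq0 x : rnorm x = 0 -> x = 0.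
Proof.
by move=> x0; apply/eqP; rewrite -normr_eq0 -[`|x|]sreK// -/(rnorm x) x0 of_real0.
Qed.

Lemma rnorm0 : rnorm 0 = 0.
Proof. by rewrite /rnorm normr0 -of_real0 of_realK. Qed.

(** The constant in bounded_op is a scalar, possibly not real; this form allows
    estimates over the reals. *)
Lemma bounded_opP (T : {linear H -> H}) :
  bounded_op T <-> exists2 c : R, 0 <= c & forall x, rnorm (T x) <= c * rnorm x.
Proof.
split=> [[c Tc]|[c c0 Tc]].
  exists (sre `|c|) => [|x]; first exact: sre_norm_ge0.
  have cx : 0 <= c * `|x| := le_trans (normr_ge0 _) (Tc x).
  rewrite -[_ * rnorm x]rnormZ /rnorm sre_le//.
  by apply: le_trans (Tc x) _; rewrite normrZ -{1}[c * `|x|]ger0_norm// normrM normr_id.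
exists (of_real k c) => x.
by rewrite -[`|T x|]sreK// -[`|x|]sreK// -of_realM of_real_le; exact: Tc.
Qed.

End RealInnerProduct.

(** * The semi-inner product of a positive operator *)

Section SemiNorm.
Context {R : realType} {k : scalar_kind} {H : hilbertType R k}.
Local Notation K := (Defs.scalar R k).
Variable A : {linear H -> H}.
Hypothesis A_pos : positive_op A.
Implicit Types (x y z : H).

Lemma redot_adjoint x y : redot (A x) y = redot x (A y).
Proof. by case: A_pos => _ AA _; rewrite /redot AA. Qed.

Lemma redot_posC x y : redot (A x) y = redot (A y) x.
Proof. by rewrite redot_adjoint redotC. Qed.

Lemma redot_pos_ge0 x : 0 <= redot (A x) x.
Proof. by case: A_pos => _ _ A0; apply: sre_ge0. Qed.

Lemma semi_norm_sqr x : semi_norm A x ^+ 2 = redot (A x) x.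
Proof. by rewrite sqr_sqrtr// redot_pos_ge0. Qed.

(** The quadratic form of A is nonnegative on the real combinations of x and y;
    suitable coefficients turn this into the inequality, also when y is null. *)
Lemma redot_CS_sqr x y :
  redot (A x) y ^+ 2 <= redot (A x) x * redot (A y) y.
Proof.
set b := redot (A x) y; set p := redot (A x) x; set q := redot (A y) y.
have p0 : 0 <= p := redot_pos_ge0 x.
have q0 : 0 <= q := redot_pos_ge0 y.
have pol s t : 0 <= s ^+ 2 * p + 2 * (s * t * b) + t ^+ 2 * q.
  have := redot_pos_ge0 (of_real k s *: x + of_real k t *: y).
  rewrite linearD !linearZ !(redotDl, redotDr) !(redotZl, redotZr) /=.
  by rewrite (redot_posC y x) -/b -/p -/q; lra.
have [q00|qn0] := eqVneq q 0; last first.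
  have qgt : 0 < q by rewrite lt_def qn0.
  have := pol q (- b).
  have -> : q ^+ 2 * p + 2 * (q * - b * b) + (- b) ^+ 2 * q =
     q * (p * q - b ^+ 2) by ring.
  by rewrite pmulr_rge0// subr_ge0.
have := pol b (- (p + 1)); rewrite q00 mulr0 addr0 mulr0 => h.
have : 0 <= b ^+ 2 * (- p - 2) by move: h; lra.
have := sqr_ge0 b; nra.
Qed.

Lemma redot_CS x y : `|redot (A x) y| <= semi_norm A x * semi_norm A y.
Proof.
rewrite -ler_sqr ?nnegrE ?mulr_ge0 ?sqrtr_ge0// real_normK ?num_real//.
by rewrite exprMn !semi_norm_sqr redot_CS_sqr.
Qed.

Lemma semi_norm_ge0 x : 0 <= semi_norm A x. Proof. exact: sqrtr_ge0. Qed.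

Lemma semi_normD x y : semi_norm A (x + y) <= semi_norm A x + semi_norm A y.
Proof.
rewrite -ler_sqr ?nnegrE ?addr_ge0 ?semi_norm_ge0//.
rewrite sqrrD !semi_norm_sqr linearD !redotDl !redotDr (redot_posC y x).
by have := le_trans (ler_norm _) (redot_CS x y); lra.
Qed.

Lemma semi_normZ (l : K) x : semi_norm A (l *: x) = sre `|l| * semi_norm A x.
Proof.
rewrite /semi_norm /semi_dotp linearZ /dotp linearZl_LR linearZr_LR /=.
rewrite mulrA mul_sconj -[`|l|]sreK// expr2 -of_realM sre_of_realM of_realK.
by rewrite -expr2 sqrtrM ?sqr_ge0// sqrtr_sqr ger0_norm// sre_norm_ge0.
Qed.

Lemma semi_norm0 : semi_norm A 0 = 0.
Proof. by rewrite /semi_norm /semi_dotp linear0 -/(redot _ _) redot0l sqrtr0. Qed.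

End SemiNorm.

Section CauchySchwarz.
Context {R : realType} {k : scalar_kind} {H : hilbertType R k}.

(** The norm of the space is the seminorm of the identity. *)
Lemma redot_le_rnorm (x y : H) : `|redot x y| <= rnorm x * rnorm y.
Proof.
have id_pos : positive_op (idfun : {linear H -> H}).
  split => [||x0]; [|by []|by rewrite /dotp dotp_norm exprn_ge0].
  by exists 1 => z; rewrite mul1r.
have semi_id z : semi_norm (idfun : {linear H -> H}) z = rnorm z.
  by rewrite /semi_norm /semi_dotp -/(redot _ _) redotxx sqrtr_sqr ger0_norm ?rnorm_ge0.
by have := redot_CS id_pos x y; rewrite !semi_id.
Qed.

End CauchySchwarz.

(** * Uniform boundedness *)

Lemma ler_bernoulli {R : realType} (q : R) n :
  1 <= q -> 1 + n%:R * (q - 1) <= q ^+ n.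
Proof.
move=> q1; elim: n => [|n IH]; first by rewrite mul0r addr0 expr0.
rewrite exprS -natr1.
have := ler_wpM2l (ltW (lt_le_trans ltr01 q1)) IH.
have n0 : 0 <= n%:R :> R by [].
have := mulr_ge0 n0 (sqr_ge0 (q - 1)).
by move=> h; apply: le_trans; lra.
Qed.

Section UniformBoundedness.
Context {R : realType} {k : scalar_kind} {H : hilbertType R k}.
Local Notation K := (Defs.scalar R k).

(** The bound is the tail 3^-n + 3^-(n+1) + ... = (3/2) 3^-n. *)
Lemma geometric_cvg (x : nat -> H) :
  (forall n, rnorm (x n.+1 - x n) <= (3^-1) ^+ n) ->
  exists l : H, forall n, 2 * rnorm (l - x n) <= 3 * (3^-1) ^+ n.
Proof.
move=> x_step.
have dist m n : 2 * rnorm (x (n + m)%N - x n) <=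
    3 * (3^-1) ^+ n - 3 * (3^-1) ^+ (n + m).
  elim: m => [|m IH]; first by rewrite addn0 !subrr rnorm0 mulr0.
  rewrite addnS; have := x_step (n + m)%N.
  have := ler_rnormD (x (n + m).+1 - x (n + m)%N) (x (n + m)%N - x n).
  by rewrite addrA subrK exprS; lra.
have dist_le m n : 2 * rnorm (x (n + m)%N - x n) <= 3 * (3^-1) ^+ n.
  have := dist m n; have : 0 <= (3^-1 : R) ^+ (n + m) by rewrite exprn_ge0 ?invr_ge0.
  by lra.
have small (e : R) : 0 < e -> exists n, 3 * (3^-1) ^+ n < e.
  move=> e0; have e30 : 0 <= 3 / e by rewrite divr_ge0// ltW.
  pose n := (Num.truncn (3 / e)).+1; exists n.
  have := @ler_bernoulli R 3 n; rewrite ler1n => /(_ isT).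
  have : 3 / e < n%:R by exact: truncnS_gt.
  rewrite ltr_pdivrMr// exprVn ltr_pdivrMr ?exprn_gt0// => ? ?.
  have : 0 <= n%:R :> R by [].
  by nra.
have F_cauchy : cauchy (x @ \oo)%classic.
  apply: cauchy_exP => e e0.
  have re0 : 0 < sre e by rewrite -(of_real_lt (k := k)) sreK ?ltW// of_real0.
  have [n n_e] := small _ re0.
  exists (x n); exists n => //= m /= /subnKC <-.
  rewrite -ball_normE /= distrC -[ltLHS]sreK// -[ltRHS]sreK ?ltW// of_real_lt.
  rewrite -/(rnorm _); apply: le_lt_trans n_e.
  by have := dist_le (m - n)%N n; have := rnorm_ge0 (x (n + (m - n))%N - x n); lra.
have /cvg_ex[/= l xl] : cvg (x @ \oo)%classic by exact: cauchy_cvg.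
exists l => n; apply/ler_addgt0Pr => e e0.
move/cvgrPdist_lt : xl => /(_ (of_real k (e / 2))).
rewrite -of_real0 of_real_lt divr_gt0// => /(_ isT)[N _ /(_ (n + N)%N)].
rewrite /= leq_addl => /(_ isT).
rewrite -[ltLHS]sreK// of_real_lt -/(rnorm _) => lN.
have := ler_rnormD (l - x (n + N)%N) (x (n + N)%N - x n).
by rewrite addrA subrK; have := dist_le N n; lra.
Qed.

(** Uniform boundedness principle for vectors seen as functionals, by a gliding
    hump.  Moving any point by r g / |g|, with the sign of its product with g,
    brings that product to size at least r |g|.  Doing so with r = 3^-n for a
    vector of norm more than 2 n 3^n, and summing up the moves, gives a limit at
    which the functionals are not bounded: the moves after the n-th add up to
    3^-n / 2, which spoils at most half of the n-th product. *)
Lemma weakly_bounded_bounded (I : Type) (g : I -> H) :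
  (forall y, exists b : R, forall i, `|redot (g i) y| <= b) ->
  exists c : R, forall i, rnorm (g i) <= c.
Proof.
move=> g_weak; apply: contrapT => /forallNP g_unbounded.
have /choice[i big] (n : nat) : exists i, 2 * n%:R * 3 ^+ n < rnorm (g i).
  by have /existsNP[i /negP] := g_unbounded (2 * n%:R * 3 ^+ n);
    rewrite -ltNge; exists i.
have g_gt0 n : 0 < rnorm (g (i n)).
  by apply: le_lt_trans (big n); rewrite !mulr_ge0 ?exprn_ge0.
pose sgn (n : nat) (y : H) : R := if 0 <= redot (g (i n)) y then 1 else -1.
pose next (n : nat) (y : H) : H :=
  y + of_real k (sgn n y * (3^-1 ^+ n / rnorm (g (i n)))) *: g (i n).
pose x := fix x n := if n is m.+1 then next m (x m) else 0.
have r0 n : 0 <= (3^-1 : R) ^+ n by rewrite exprn_ge0 ?invr_ge0.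
have x_step n : rnorm (x n.+1 - x n) <= (3^-1) ^+ n.
  rewrite /= /next addrAC subrr add0r rnormZ.
  have -> : sre `|of_real k (sgn n (x n) * (3^-1 ^+ n / rnorm (g (i n))))| =
     3^-1 ^+ n / rnorm (g (i n)).
    rewrite /sgn; case: ifP => _.
      by rewrite mul1r sre_norm_of_real ?divr_ge0 ?rnorm_ge0.
    rewrite mulN1r; have -> (t : R) : of_real k (- t) = - of_real k t.
      by apply/eqP; rewrite -addr_eq0 -of_realD addNr of_real0.
    by rewrite normrN sre_norm_of_real ?divr_ge0 ?rnorm_ge0.
  by rewrite divfK// gt_eqF.
have [l x_l] := geometric_cvg x_step.
have [b g_l] := g_weak l.
have [n b_n] : exists n, b < n%:R by exists (Num.truncn b).+1; exact: truncnS_gt.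
have := g_l (i n); apply/negP; rewrite -ltNge; apply: lt_le_trans b_n _.
have hump : 3^-1 ^+ n * rnorm (g (i n)) <= `|redot (g (i n)) (x n.+1)|.
  rewrite /= /next redotDr redotZr redotxx expr2 mulrA.
  rewrite -[sgn _ _ * _ * _]mulrA divfK ?gt_eqF//.
  rewrite -mulrA.
  have := mulr_ge0 (r0 n) (rnorm_ge0 (g (i n))).
  rewrite /sgn; case: ifPn; rewrite -?ltNge => ? ?; first by rewrite ger0_norm; lra.
  by rewrite ltr0_norm; lra.
have tail : 2 * `|redot (g (i n)) (l - x n.+1)| <= 3^-1 ^+ n * rnorm (g (i n)).
  have := redot_le_rnorm (g (i n)) (l - x n.+1).
  have := ler_wpM2r (rnorm_ge0 (g (i n))) (x_l n.+1); rewrite exprS; lra.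
have r3 : 3^-1 ^+ n * 3 ^+ n = 1 :> R by rewrite -exprMn mulVf ?expr1n// pnatr_eq0.
have : 2 * n%:R <= 3^-1 ^+ n * rnorm (g (i n)).
  have := ler_wpM2l (r0 n) (ltW (big n)).
  have -> : 3^-1 ^+ n * (2 * n%:R * 3 ^+ n) =
      2 * n%:R * (3^-1 ^+ n * 3 ^+ n) :> R by ring.
  by rewrite r3 mulr1.
have := lerB_dist (redot (g (i n)) (x n.+1)) (redot (g (i n)) (x n.+1 - l)).
rewrite -redotBr subKr => h; move: h.
have -> : `|redot (g (i n)) (x n.+1 - l)| =
    `|redot (g (i n)) (l - x n.+1)|.
  by rewrite !redotBr distrC.
lra.
Qed.

End UniformBoundedness.

(** * Adjointable operators are bounded for the seminorm *)

Section AdjointableBounded.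
Context {R : realType} {k : scalar_kind} {H : hilbertType R k}.
Implicit Types A T : {linear H -> H}.

(** If q = p 1 / (D p 0) exceeded 1, iterated log-convexity would force p (2^j)
    to be at least (q D)^(2^j) p 0, faster than the growth allowed. *)
Lemma log_convex_growth (p : nat -> R) (K D : R) :
  0 < D -> 0 <= p 0%N ->
  (forall n, p n ^+ 2 <= p (n + n)%N * p 0%N) ->
  (forall n, p n <= K * D ^+ n) ->
  p 1%N <= D * p 0%N.
Proof.
move=> D0; rewrite le_eqVlt => /predU1P[p00|p0] p_conv p_le.
  by have := p_conv 1%N; rewrite -p00 !mulr0 => ?; nra.
rewrite leNgt; apply/negP => p1.
pose q := p 1%N / (D * p 0%N).
have q1 : 1 < q by rewrite ltr_pdivlMr ?mulr_gt0// mul1r.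
have q0 : 0 < q by exact: lt_trans q1.
have p_ge j : q ^+ (2 ^ j) * D ^+ (2 ^ j) * p 0%N <= p (2 ^ j)%N.
  elim: j => [|j IH].
    by rewrite expn0 !expr1 -mulrA /q divfK// mulf_neq0// gt_eqF.
  rewrite -(ler_pM2r p0) expnS mul2n -addnn; apply: le_trans (p_conv _).
  have -> : q ^+ (2 ^ j + 2 ^ j) * D ^+ (2 ^ j + 2 ^ j) * p 0%N * p 0%N =
      (q ^+ (2 ^ j) * D ^+ (2 ^ j) * p 0%N) ^+ 2 by rewrite !exprD; ring.
  have Q0 : 0 <= q ^+ (2 ^ j) * D ^+ (2 ^ j) * p 0%N.
    by rewrite !mulr_ge0 ?exprn_ge0// ltW.
  by rewrite ler_sqr ?nnegrE// (le_trans Q0).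
have [j j_gt] : exists j, K / p 0%N < 1 + (2 ^ j)%N%:R * (q - 1).
  pose j := (Num.truncn (K / p 0%N / (q - 1))).+1; exists j.
  have : K / p 0%N / (q - 1) < j%:R by exact: truncnS_gt.
  rewrite ltr_pdivrMr ?subr_gt0// => /lt_le_trans; apply.
  rewrite ler_wpDl// ler_wpM2r ?subr_ge0 ?(ltW q1)// ler_nat.
  exact/ltnW/ltn_expl.
have := le_trans (p_ge j) (p_le (2 ^ j)%N).
rewrite mulrAC ler_pM2r ?exprn_gt0// -ler_pdivlMr// leNgt => /negP; apply.
by apply: lt_le_trans j_gt _; apply: ler_bernoulli; exact: ltW.
Qed.

(** The half of Douglas' lemma that is needed.  With A z = T^* A y, the product
    <A T w, y> equals <A w, z>, so the vectors A T w / |A w| are weakly bounded. *)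
Lemma range_inclusion_majorization A T Tstar :
  positive_op A -> is_adjoint T Tstar ->
  (forall x, exists y, A y = Tstar (A x)) ->
  exists2 c : R, 0 <= c & forall x, rnorm (A (T x)) <= c * rnorm (A x).
Proof.
move=> A_pos T_adj AT.
have ATE w y z : A z = Tstar (A y) -> redot (A (T w)) y = redot (A w) z.
  by move=> Az; rewrite !(redot_adjoint A_pos) Az /redot T_adj.
(* When A w = 0, g w is 0 as inverting 0 gives 0; that case is separate below. *)
pose g w : H := of_real k (rnorm (A w))^-1 *: A (T w).
have [|c g_le] := @weakly_bounded_bounded R k H H g.
  move=> y; have [z Az] := AT y; exists (rnorm z) => w.
  rewrite redotZl (ATE _ _ _ Az) normrM ger0_norm ?invr_ge0 ?rnorm_ge0//.
  have [->|Aw0] := eqVneq (rnorm (A w)) 0; first by rewrite invr0 mul0r rnorm_ge0.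
  by rewrite ler_pdivrMl ?redot_le_rnorm// lt_def Aw0 rnorm_ge0.
exists c => [|w]; first exact: le_trans (rnorm_ge0 _) (g_le 0).
have [Aw0|Aw0] := eqVneq (rnorm (A w)) 0.
  suff -> : A (T w) = 0 by rewrite rnorm0 Aw0 mulr0.
  apply: rnorm_eq0; apply/eqP; rewrite -sqrf_eq0 -redotxx.
  have [z Az] := AT (A (T w)).
  by rewrite (ATE _ _ _ Az) (rnorm_eq0 Aw0) redot0l.
have Aw_gt0 : 0 < rnorm (A w) by rewrite lt_def Aw0 rnorm_ge0.
have := g_le w; rewrite rnormZ.
by rewrite sre_norm_of_real ?invr_ge0 ?rnorm_ge0// ler_pdivrMl// mulrC.
Qed.

(** The map f, a choice of preimages of T^* A T under A, need not be linear, but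
    it is symmetric for the semi-inner product; hence <A f^i x, f^j x> depends
    on i + j only, and Cauchy-Schwarz makes the moments log-convex. *)
Lemma semi_adjointable_bounded A T :
  positive_op A -> semi_adjointable A T -> semi_bounded A T.
Proof.
move=> A_pos [T_bd [Tstar [/bounded_opP[c c0 Tstar_le] T_adj AT]]].
have {}AT x : exists y, A y = Tstar (A x).
  by have [y _ Ay] := AT _ (ex_intro2 _ _ x Logic.I erefl); exists y.
have [C C0 AT_le] := range_inclusion_majorization A_pos T_adj AT.
have /choice[f fE] (x : H) : exists y, A y = Tstar (A (T x)) by exact: AT.
have f_sym u v : redot (A (f u)) v = redot (A u) (f v).
  rewrite (redot_adjoint A_pos u) !fE (redotC (Tstar _)) /redot -!T_adj.
  by rewrite -/(redot _ _) redotC redot_adjoint.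
have f_shift i j x :
    redot (A (iter i f x)) (iter j f x) = redot (A (iter (i + j) f x)) x.
  by elim: j i => [|j IH] i; rewrite ?addn0// addnS -addSn -IH /= f_sym.
pose D := c * C + 1.
have D0 : 0 < D by rewrite ltr_wpDl// mulr_ge0.
have A_growth n x : rnorm (A (iter n f x)) <= D ^+ n * rnorm (A x).
  elim: n => [|n IH]; first by rewrite mul1r.
  rewrite /= fE exprS -mulrA.
  apply: le_trans (Tstar_le _) _; apply: le_trans (ler_wpM2l c0 (AT_le _)) _.
  rewrite [leLHS]mulrA.
  by apply: ler_pM; rewrite // ?mulr_ge0 ?rnorm_ge0 ?lerDl.
split=> //; exists (Num.sqrt D) => [|x]; first by rewrite sqrtr_gt0.
rewrite -ler_sqr ?nnegrE ?mulr_ge0 ?sqrtr_ge0// exprMn.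
rewrite !semi_norm_sqr// sqr_sqrtr ?(ltW D0)//.
pose p n := redot (A (iter n f x)) x.
have -> : redot (A (T x)) (T x) = p 1%N.
  by rewrite /p /= fE [RHS]redotC [RHS]/redot -T_adj -/(redot _ _) redotC.
apply: (@log_convex_growth p (rnorm (A x) * rnorm x)) => // [|n|n].
- exact: redot_pos_ge0.
- by rewrite /p -f_shift; exact: redot_CS_sqr.
- apply: le_trans (ler_norm _) _; apply: le_trans (redot_le_rnorm _ _) _.
  by have := ler_wpM2r (rnorm_ge0 x) (A_growth n x); rewrite /D; lra.
Qed.

End AdjointableBounded.

(** * The operator seminorm *)

Section OperatorSeminorm.
Context {R : realType} {k : scalar_kind} {H : hilbertType R k}.
Local Notation K := (Defs.scalar R k).
Variable A : {linear H -> H}.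
Hypothesis A_pos : positive_op A.
Implicit Types (x y : H) (S T : {linear H -> H}).

Lemma semi_opnorm_ge0 (F : H -> H) : 0 <= semi_opnorm A F.
Proof.
rewrite /semi_opnorm; set E := (X in sup X).
have [E_sup|/sup_out -> //] := pselect (has_sup E).
have [[_ [x x1 _]] _] := E_sup.
by apply: le_trans (semi_norm_ge0 _ _) (sup_upper_bound E_sup _); exists x.
Qed.

(** Vectors of seminorm 0, which no rescaling brings to the unit sphere, are
    covered because a semi-bounded operator maps them to such vectors. *)
Lemma semi_opnorm_ub T x :
  semi_bounded A T -> semi_norm A (T x) <= semi_opnorm A T * semi_norm A x.
Proof.
move=> [_ [c c0 Tc]].
have [x0|xn0] := eqVneq (semi_norm A x) 0.
  by apply: le_trans (Tc x) _; rewrite x0 !mulr0.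
have x_gt0 : 0 < semi_norm A x by rewrite lt_def xn0 semi_norm_ge0.
pose u := of_real k (semi_norm A x)^-1 *: x.
have uE : semi_norm A (T u) = semi_norm A (T x) / semi_norm A x.
  by rewrite linearZ semi_normZ// sre_norm_of_real ?invr_ge0 ?ltW// mulrC.
rewrite -ler_pdivrMr// -uE; apply: ub_le_sup.
  by exists c => _ [y /= y1 <-]; have := Tc y; rewrite y1 mulr1.
exists u => //=.
by rewrite semi_normZ// sre_norm_of_real ?invr_ge0 ?ltW// mulVf.
Qed.

(** An empty unit sphere is harmless, the supremum of the empty set being 0. *)
Lemma semi_opnorm_le (F : H -> H) (c : R) :
  0 <= c -> (forall x, semi_norm A (F x) <= c * semi_norm A x) ->
  semi_opnorm A F <= c.
Proof.
move=> c0 Fc; rewrite /semi_opnorm; set E := (X in sup X).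
have [->|E0] := eqVneq E set0; first by rewrite sup0.
apply: ge_sup; first exact/set0P.
by move=> _ [y /= y1 <-]; have := Fc y; rewrite y1 mulr1.
Qed.

Lemma semi_boundedDZ S T (l : K) :
  semi_bounded A T -> semi_bounded A S -> semi_bounded A (T \+ l \*: S).
Proof.
move=> [/bounded_opP[b b0 Tb] [c c0 Tc]] [/bounded_opP[b' b'0 Sb] [c' c'0 Sc]].
have l0 := sre_norm_ge0 l.
split.
  apply/bounded_opP; exists (b + sre `|l| * b') => [|x].
    by rewrite addr_ge0 ?mulr_ge0.
  rewrite /=; apply: le_trans (ler_rnormD _ _) _; rewrite rnormZ mulrDl -mulrA.
  by rewrite lerD// ler_wpM2l.
exists (c + sre `|l| * c') => [|x]; first by rewrite ltr_wpDr ?mulr_ge0// ltW.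
rewrite /=; apply: le_trans (semi_normD A_pos _ _) _.
by rewrite semi_normZ// mulrDl -mulrA lerD// ler_wpM2l.
Qed.

Lemma semi_boundedD S T :
  semi_bounded A T -> semi_bounded A S -> semi_bounded A (T \+ S).
Proof.
move=> T_sb S_sb.
have [[b TSb] [c c0 TSc]] := semi_boundedDZ 1 T_sb S_sb.
have E x : T x + S x = (T \+ 1 \*: S) x by rewrite /= scale1r.
split; last by exists c => // x; rewrite [X in semi_norm A X]E; exact: TSc.
by exists b => x; rewrite [X in `|X|]E; exact: TSb.
Qed.

Lemma semi_bounded0 : semi_bounded A (\0 : {linear H -> H}).
Proof.
split; first by exists 0 => x; rewrite /= normr0 mul0r.
by exists 1 => // x; rewrite /= semi_norm0 mul1r semi_norm_ge0.
Qed.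

End OperatorSeminorm.

(** * Block operators on a direct sum *)

Section Blocks.
Context {R : realType} {k : scalar_kind} {H1 H2 : hilbertType R k}.
Local Notation K := (Defs.scalar R k).
Local Notation HH := (hsum H1 H2).
Variables (A1 : {linear H1 -> H1}) (A2 : {linear H2 -> H2}).
Hypotheses (A1_pos : positive_op A1) (A2_pos : positive_op A2).
Local Notation AA := (diag_op A1 A2 : {linear HH -> HH}).
Implicit Types (x : HH) (S : {linear HH -> HH}).

Lemma rnorm_hsum x : rnorm x ^+ 2 = rnorm x.1 ^+ 2 + rnorm x.2 ^+ 2.
Proof. by rewrite -!redotxx /redot dotp_hsumE sreD. Qed.

Lemma diag_op_bounded (M : {linear H1 -> H1}) (N : {linear H2 -> H2}) :
  bounded_op M -> bounded_op N -> bounded_op (diag_op M N : {linear HH -> HH}).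
Proof.
move=> /bounded_opP[b b0 Mb] /bounded_opP[c c0 Nc]; apply/bounded_opP.
exists (b + c) => [|x]; first exact: addr_ge0.
rewrite -ler_sqr ?nnegrE ?mulr_ge0 ?addr_ge0 ?rnorm_ge0// exprMn !rnorm_hsum /=.
have bc : 0 <= b * c by rewrite mulr_ge0.
rewrite mulrDr -!exprMn; apply: lerD.
  rewrite ler_sqr ?nnegrE ?mulr_ge0 ?addr_ge0 ?rnorm_ge0//.
  by rewrite (le_trans (Mb _))// ler_wpM2r ?rnorm_ge0// lerDl.
rewrite ler_sqr ?nnegrE ?mulr_ge0 ?addr_ge0 ?rnorm_ge0//.
by rewrite (le_trans (Nc _))// ler_wpM2r ?rnorm_ge0// lerDr.
Qed.

Lemma diag_op_positive : positive_op AA.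
Proof.
case: A1_pos A2_pos => [b1 s1 p1] [b2 s2 p2]; split.
- exact: diag_op_bounded.
- by move=> x y; rewrite !dotp_hsumE /= s1 s2.
- by move=> x; rewrite dotp_hsumE addr_ge0 ?p1 ?p2.
Qed.

Lemma semi_norm_diag x :
  semi_norm AA x ^+ 2 = semi_norm A1 x.1 ^+ 2 + semi_norm A2 x.2 ^+ 2.
Proof.
by rewrite !semi_norm_sqr //; [rewrite /redot dotp_hsumE sreD|exact: diag_op_positive].
Qed.

Lemma semi_norm_fst x : semi_norm A1 x.1 <= semi_norm AA x.
Proof. by rewrite -ler_sqr ?nnegrE ?semi_norm_ge0// semi_norm_diag lerDl sqr_ge0. Qed.

Lemma semi_norm_snd x : semi_norm A2 x.2 <= semi_norm AA x.
Proof. by rewrite -ler_sqr ?nnegrE ?semi_norm_ge0// semi_norm_diag lerDr sqr_ge0. Qed.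

Lemma semi_norm_inl (u : H1) : semi_norm AA ((u, 0) : HH) = semi_norm A1 u.
Proof.
apply/eqP; rewrite -(@eqrXn2 _ 2) ?semi_norm_ge0// semi_norm_diag /=.
by rewrite semi_norm0 expr0n addr0.
Qed.

Lemma semi_norm_inr (v : H2) : semi_norm AA ((0, v) : HH) = semi_norm A2 v.
Proof.
apply/eqP; rewrite -(@eqrXn2 _ 2) ?semi_norm_ge0// semi_norm_diag /=.
by rewrite semi_norm0 expr0n add0r.
Qed.

Lemma semi_bounded_diag (M : {linear H1 -> H1}) (N : {linear H2 -> H2}) :
  semi_bounded A1 M -> semi_bounded A2 N -> semi_bounded AA (diag_op M N).
Proof.
move=> [Mbd [b b0 Mb]] [Nbd [c c0 Nc]]; split; first exact: diag_op_bounded.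
exists (b + c) => [|x]; first exact: addr_gt0.
have bc0 : 0 <= b + c by rewrite addr_ge0// ltW.
rewrite -ler_sqr ?nnegrE ?mulr_ge0 ?semi_norm_ge0// exprMn !semi_norm_diag /=.
rewrite mulrDr -!exprMn; apply: lerD.
  rewrite ler_sqr ?nnegrE ?mulr_ge0 ?semi_norm_ge0//.
  by rewrite (le_trans (Mb _))// ler_wpM2r ?semi_norm_ge0// lerDl ltW.
rewrite ler_sqr ?nnegrE ?mulr_ge0 ?semi_norm_ge0//.
by rewrite (le_trans (Nc _))// ler_wpM2r ?semi_norm_ge0// lerDr ltW.
Qed.

Lemma semi_bounded_diagP (M : {linear H1 -> H1}) (N : {linear H2 -> H2}) :
  bounded_op M -> bounded_op N ->
  semi_bounded AA (diag_op M N) -> semi_bounded A1 M /\ semi_bounded A2 N.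
Proof.
move=> Mbd Nbd [_ [c c0 Tc]]; split; split=> //; exists c => // u.
  have := Tc (u, 0); rewrite semi_norm_inl; apply: le_trans.
  exact: (semi_norm_fst (M u, N 0)).
have := Tc (0, u); rewrite semi_norm_inr; apply: le_trans.
exact: (semi_norm_snd (M 0, N u)).
Qed.

Lemma semi_opnorm_diag_le (M : {linear H1 -> H1}) (N : {linear H2 -> H2}) (c : R) :
  semi_bounded A1 M -> semi_bounded A2 N ->
  semi_opnorm A1 M <= c -> semi_opnorm A2 N <= c -> semi_opnorm AA (diag_op M N) <= c.
Proof.
move=> Msb Nsb Mc Nc.
have c0 : 0 <= c := le_trans (semi_opnorm_ge0 _ _) Mc.
apply: semi_opnorm_le => // x.
rewrite -ler_sqr ?nnegrE ?mulr_ge0 ?semi_norm_ge0// exprMn !semi_norm_diag /=.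
rewrite mulrDr -!exprMn; apply: lerD.
  rewrite ler_sqr ?nnegrE ?mulr_ge0 ?semi_norm_ge0//.
  by rewrite (le_trans (semi_opnorm_ub _ Msb))// ler_wpM2r ?semi_norm_ge0.
rewrite ler_sqr ?nnegrE ?mulr_ge0 ?semi_norm_ge0//.
by rewrite (le_trans (semi_opnorm_ub _ Nsb))// ler_wpM2r ?semi_norm_ge0.
Qed.

Definition compress1 S (u : H1) : H1 := (S (u, 0)).1.

Fact compress1_is_linear S : linear (compress1 S).
Proof.
move=> l u v; rewrite /compress1.
have -> : (l *: u + v, 0) = l *: ((u, 0) : HH) + (v, 0) :> HH.
  by congr (_, _) => /=; rewrite scaler0 addr0.
by rewrite linearP.
Qed.

HB.instance Definition _ S := GRing.isLinear.Build K H1 H1 _ (compress1 S)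
  (compress1_is_linear S).

Lemma semi_bounded_compress1 S : semi_bounded AA S -> semi_bounded A1 (compress1 S).
Proof.
move=> [/bounded_opP[b b0 Sb] [c c0 Sc]]; split; last first.
  exists c => // u; rewrite -(semi_norm_inl u).
  exact: le_trans (semi_norm_fst (S (u, 0))) (Sc _).
apply/bounded_opP; exists b => // u.
have -> : rnorm u = rnorm ((u, 0) : HH).
  by apply/eqP; rewrite -(@eqrXn2 _ 2) ?rnorm_ge0// rnorm_hsum /= rnorm0 expr0n addr0.
apply: le_trans (Sb _); rewrite /compress1.
by rewrite -ler_sqr ?nnegrE ?rnorm_ge0// rnorm_hsum lerDl sqr_ge0.
Qed.

Lemma semi_opnorm_compress1 S :
  semi_bounded AA S -> semi_opnorm A1 (compress1 S) <= semi_opnorm AA S.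
Proof.
move=> Ssb; apply: semi_opnorm_le => [|u]; first exact: semi_opnorm_ge0.
rewrite -(semi_norm_inl u); apply: le_trans (semi_opnorm_ub _ Ssb).
exact: (semi_norm_fst (S (u, 0))).
Qed.

End Blocks.

(** * Orthogonality when the first block dominates *)

(** For the symmetric matrix P with rows (p, b) and (b, q), the hypotheses say
    that s - P is positive semidefinite.  By Cayley-Hamilton
    s^2 - P^2 = (p + q) (s - P) + ((s - p) (s - q) - b^2), a sum of positive
    semidefinite matrices. *)
Lemma symmetric2_norm_le {R : realType} (p b q s u v : R) :
  0 <= p -> 0 <= q -> p <= s -> q <= s -> b ^+ 2 <= (s - p) * (s - q) ->
  (p * u + b * v) ^+ 2 + (b * u + q * v) ^+ 2 <= s ^+ 2 * (u ^+ 2 + v ^+ 2).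
Proof.
move=> p0 q0 ps qs b_le.
have form_ge0 : 0 <= (s - p) * u ^+ 2 - 2 * b * u * v + (s - q) * v ^+ 2.
  have [sp0|sp_n0] := eqVneq (s - p) 0.
    have b0 : b = 0.
      by apply/eqP; rewrite -sqrf_eq0 eq_le sqr_ge0 andbT (le_trans b_le)// sp0 mul0r.
    rewrite sp0 b0 mul0r mulr0 !mul0r subr0 add0r.
    by apply: mulr_ge0; rewrite ?subr_ge0 ?sqr_ge0.
  have sp_gt0 : 0 < s - p by rewrite lt_def sp_n0 subr_ge0.
  rewrite -(pmulr_rge0 _ sp_gt0).
  have -> : (s - p) * ((s - p) * u ^+ 2 - 2 * b * u * v + (s - q) * v ^+ 2) =
    ((s - p) * u - b * v) ^+ 2 + ((s - p) * (s - q) - b ^+ 2) * v ^+ 2 by ring.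
  by apply: addr_ge0; last apply: mulr_ge0; rewrite ?subr_ge0 ?sqr_ge0.
rewrite -subr_ge0.
have -> : s ^+ 2 * (u ^+ 2 + v ^+ 2) -
    ((p * u + b * v) ^+ 2 + (b * u + q * v) ^+ 2) =
  (p + q) * ((s - p) * u ^+ 2 - 2 * b * u * v + (s - q) * v ^+ 2) +
  ((s - p) * (s - q) - b ^+ 2) * (u ^+ 2 + v ^+ 2) by ring.
apply: addr_ge0; apply: mulr_ge0 => //; first exact: addr_ge0.
  by rewrite subr_ge0.
by rewrite addr_ge0 ?sqr_ge0.
Qed.

(** The left side of the last inequality is quadratic in t and its right side is
    of order t d e / 2, so all conditions hold for t small enough. *)
Lemma small_parameter {R : realType} (c d e : R) :
  0 < c -> 0 < d -> 0 < e ->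
  exists t : R, [/\ 0 < t, t <= 1, t * (c + d) <= e
    & (t * c) ^+ 2 <= (t * (d / 2)) * (e - t * (c + d / 2))].
Proof.
move=> c0 d0 e0.
pose t := Num.min 1 (Num.min (e / (2 * (c + d))) (d * e / (4 * c ^+ 2))).
have cd0 : 0 < 2 * (c + d) by rewrite mulr_gt0// addr_gt0.
have c20 : 0 < 4 * c ^+ 2 by rewrite mulr_gt0// exprn_gt0.
have t0 : 0 < t by rewrite !lt_min ltr01 !divr_gt0// mulr_gt0.
have t1 : t <= 1 by rewrite ge_min lexx.
have te : t * (2 * (c + d)) <= e by rewrite -ler_pdivlMr// !ge_min lexx orbT.
have tde : t * (4 * c ^+ 2) <= d * e by rewrite -ler_pdivlMr// !ge_min lexx !orbT.
exists t; split => //; first by lra.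
have td0 : 0 < t * d by rewrite mulr_gt0.
have : t * (t * (4 * c ^+ 2)) <= t * (d * e) by rewrite ler_pM2l.
have : t * d * (t * (2 * (c + d / 2))) <= t * d * e by rewrite ler_pM2l//; lra.
by nra.
Qed.

Section Dominant.
Context {R : realType} {k : scalar_kind} {H1 H2 : hilbertType R k}.
Local Notation K := (Defs.scalar R k).
Local Notation HH := (hsum H1 H2).
Variables (A1 : {linear H1 -> H1}) (A2 : {linear H2 -> H2}).
Hypotheses (A1_pos : positive_op A1) (A2_pos : positive_op A2).
Variables (M : {linear H1 -> H1}) (N : {linear H2 -> H2}).
Hypotheses (M_sb : semi_bounded A1 M) (N_sb : semi_bounded A2 N).
Local Notation AA := (diag_op A1 A2 : {linear HH -> HH}).
Local Notation T := (diag_op M N : {linear HH -> HH}).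
Implicit Types (x : HH) (S : {linear HH -> HH}).

Let AA_pos : positive_op AA := diag_op_positive A1_pos A2_pos.
Let T_sb : semi_bounded AA T := semi_bounded_diag A1_pos A2_pos M_sb N_sb.

Lemma semi_opnorm_diag_ge1 : semi_opnorm A1 M <= semi_opnorm AA T.
Proof. exact: (semi_opnorm_compress1 A1_pos A2_pos T_sb). Qed.

(** The seminorms of the blocks of T + t l S are dominated by the symmetric
    matrix with rows (a - t (a - m), t c) and (t c, b + t c), where c bounds
    l S.  For t small its norm is at most s = a - t (a - m) / 2, half of the
    gain in the first block paying for the off-diagonal entries. *)
Lemma compress1_perturb_lt S (l : K) :
  semi_opnorm A2 N < semi_opnorm A1 M -> semi_bounded AA S ->
  semi_opnorm A1 (fun u => M u + l *: compress1 S u) < semi_opnorm A1 M ->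
  exists l', semi_opnorm AA (fun x => T x + l' *: S x) < semi_opnorm AA T.
Proof.
move=> NM S_sb; set m := semi_opnorm A1 (fun _ => _) => mM.
set a := semi_opnorm A1 M in NM mM; set b := semi_opnorm A2 N in NM.
have Ml_sb : semi_bounded A1 (M \+ l *: compress1 S).
  exact: (semi_boundedDZ A1_pos l M_sb (semi_bounded_compress1 A1_pos A2_pos S_sb)).
have [_ [c0 c0_gt0 S_le]] := S_sb.
have l0 := sre_norm_ge0 l.
(* Adding 1 makes c positive even if l is 0. *)
pose c := sre `|l| * c0 + 1.
have c_gt0 : 0 < c by rewrite ltr_wpDl// mulr_ge0// ltW.
have lS_le x : semi_norm AA (l *: S x) <= c * semi_norm AA x.
  rewrite semi_normZ; apply: le_trans (ler_wpM2l l0 (S_le x)) _.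
  by rewrite mulrA ler_wpM2r ?semi_norm_ge0// lerDl.
have m0 : 0 <= m := semi_opnorm_ge0 _ _.
have b0 : 0 <= b := semi_opnorm_ge0 _ _.
have [t [t0 t1 t_e t_c]] : exists t : R, [/\ 0 < t, t <= 1, t * (c + (a - m)) <= a - b
    & (t * c) ^+ 2 <= (t * ((a - m) / 2)) * (a - b - t * (c + (a - m) / 2))].
  by apply: small_parameter; rewrite ?subr_gt0.
have t0' := ltW t0.
exists (of_real k t * l).
pose s := a - t * ((a - m) / 2).
have s_lt : s < a by rewrite gtrBl mulr_gt0// divr_gt0// subr_gt0.
apply: le_lt_trans (lt_le_trans s_lt semi_opnorm_diag_ge1).
have am : t * (a - m) <= a - m by rewrite ler_piMl// subr_ge0 ltW.
have am0 : 0 <= t * (a - m) by rewrite mulr_ge0// subr_ge0 ltW.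
apply: semi_opnorm_le => [|x]; first by rewrite /s; lra.
have u0 := semi_norm_ge0 A1 x.1; have v0 := semi_norm_ge0 A2 x.2.
set u := semi_norm A1 x.1 in u0 *; set v := semi_norm A2 x.2 in v0 *.
have xE : x = ((x.1, 0) : HH) + (0, x.2).
  by rewrite [LHS]surjective_pairing; congr (_, _) => /=; rewrite ?addr0 ?add0r.
have tZ (H : hilbertType R k) (B : {linear H -> H}) (r : R) (w : H) : 0 <= r ->
    semi_norm B (of_real k r *: w) = r * semi_norm B w.
  by move=> r0; rewrite semi_normZ sre_norm_of_real.
have lSu_le := lS_le (x.1, 0); rewrite (semi_norm_inl A1_pos A2_pos) -/u in lSu_le.
have lSv_le := lS_le (0, x.2); rewrite (semi_norm_inr A1_pos A2_pos) -/v in lSv_le.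
set F := _ + _.
have F1 : semi_norm A1 F.1 <= (a - t * (a - m)) * u + t * c * v.
  have -> : F.1 = (of_real k (1 - t) *: M x.1 +
      of_real k t *: (M x.1 + l *: compress1 S x.1)) +
      of_real k t *: (l *: S (0, x.2)).1.
    rewrite /F [in S x]xE [S (_ + _)]linearD /= /compress1 -scalerA !scalerDr.
    have -> : of_real k (1 - t) = 1 - of_real k t.
      by apply/eqP; rewrite eq_sym subr_eq -of_realD subrK; case: (k).
    by rewrite scalerBl scale1r !addrA subrK.
  apply: le_trans (semi_normD A1_pos _ _) _.
  have hD := semi_normD A1_pos (of_real k (1 - t) *: M x.1)
    (of_real k t *: (M x.1 + l *: compress1 S x.1)).
  have hM := ler_wpM2l (_ : 0 <= 1 - t) (semi_opnorm_ub x.1 M_sb).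
  have hm := ler_wpM2l t0' (semi_opnorm_ub x.1 Ml_sb).
  have hS := ler_wpM2l t0'
    (le_trans (semi_norm_fst A1_pos A2_pos (l *: S (0, x.2))) lSv_le).
  apply: le_trans (lerD hD (lexx _)) _; rewrite !tZ ?subr_ge0//.
  apply: le_trans (lerD (lerD (hM _) hm) hS) _; rewrite ?subr_ge0//.
  by rewrite -/a -/u -/m; lra.
have F2 : semi_norm A2 F.2 <= t * c * u + (b + t * c) * v.
  have -> : F.2 = N x.2 + of_real k t *: ((l *: S (x.1, 0)).2 + (l *: S (0, x.2)).2).
    by rewrite /F [in S x]xE [S (_ + _)]linearD /= -scalerA !scalerDr.
  apply: le_trans (semi_normD A2_pos _ _) _; rewrite tZ//.
  have Nv := semi_opnorm_ub x.2 N_sb; rewrite -/b -/v in Nv.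
  have h1 := le_trans (semi_norm_snd A1_pos A2_pos (l *: S (x.1, 0))) lSu_le.
  have h2 := le_trans (semi_norm_snd A1_pos A2_pos (l *: S (0, x.2))) lSv_le.
  have := ler_wpM2l t0' (le_trans (semi_normD A2_pos _ _) (lerD h1 h2)).
  by lra.
have F1_0 := semi_norm_ge0 A1 F.1; have F2_0 := semi_norm_ge0 A2 F.2.
rewrite -ler_sqr ?nnegrE ?mulr_ge0 ?semi_norm_ge0//; last by rewrite /s; lra.
rewrite exprMn !semi_norm_diag// -/u -/v.
apply: le_trans (symmetric2_norm_le (p := a - t * (a - m)) (b := t * c)
  (q := b + t * c) _ _ _ _ _ _ _).
- by apply: lerD; apply: lerXn2r; rewrite ?nnegrE// (le_trans _ F1, le_trans _ F2).
- lra.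
- by rewrite addr_ge0// mulr_ge0// ltW.
- by rewrite /s; lra.
- by rewrite /s; lra.
- by rewrite /s; lra.
Qed.

(** One direction is the estimate above, the other holds since compression does
    not increase seminorms and T has the same seminorm as M. *)
Lemma BJ_orthogonal_diag S :
  semi_opnorm A2 N < semi_opnorm A1 M -> semi_bounded AA S ->
  semi_BJ_orthogonal AA T S <-> semi_BJ_orthogonal A1 M (compress1 S).
Proof.
move=> NM S_sb; split=> [TS l|MS l].
  rewrite leNgt; apply/negP => /(compress1_perturb_lt NM S_sb)[l' l'_lt].
  by have := TS l'; rewrite leNgt l'_lt.
apply: le_trans (semi_opnorm_diag_le A1_pos A2_pos M_sb N_sb (lexx _) (ltW NM)) _.
apply: le_trans (MS l) _.
exact: (semi_opnorm_compress1 A1_pos A2_pos (semi_boundedDZ AA_pos l T_sb S_sb)).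
Qed.

End Dominant.

(** * Smoothness of block diagonal operators *)

Section Smoothness.
Context {R : realType} {k : scalar_kind} {H1 H2 : hilbertType R k}.
Local Notation K := (Defs.scalar R k).
Local Notation HH := (hsum H1 H2).
Variables (A1 : {linear H1 -> H1}) (A2 : {linear H2 -> H2}).
Hypotheses (A1_pos : positive_op A1) (A2_pos : positive_op A2).
Variables (M : {linear H1 -> H1}) (N : {linear H2 -> H2}).
Hypotheses (M_sb : semi_bounded A1 M) (N_sb : semi_bounded A2 N).
Local Notation AA := (diag_op A1 A2 : {linear HH -> HH}).
Local Notation T := (diag_op M N : {linear HH -> HH}).

Let AA_pos : positive_op AA := diag_op_positive A1_pos A2_pos.
Let T_sb : semi_bounded AA T := semi_bounded_diag A1_pos A2_pos M_sb N_sb.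

(** Going down, operators on the first summand are extended by 0, which
    compression undoes; going up, operators on the sum are compressed. *)
Lemma semi_smooth_diag : semi_opnorm A2 N < semi_opnorm A1 M ->
  semi_smooth AA T <-> semi_smooth A1 M.
Proof.
move=> NM.
have M_gt0 : 0 < semi_opnorm A1 M by exact: le_lt_trans (semi_opnorm_ge0 _ _) NM.
split=> [[_ _ T_add]|[_ _ M_add]]; split=> //.
- by rewrite gt_eqF.
- move=> S1 S2 S1_sb S2_sb MS1 MS2.
  have lift (S : {linear H1 -> H1}) : semi_bounded A1 S ->
      semi_BJ_orthogonal A1 M S <->
      semi_BJ_orthogonal AA T (diag_op S (\0 : {linear H2 -> H2})).
    move=> S_sb; apply: iff_sym.
    exact: (BJ_orthogonal_diag A1_pos A2_pos M_sb N_sb NM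
      (semi_bounded_diag A1_pos A2_pos S_sb (semi_bounded0 _))).
  apply/(lift (S1 \+ S2)); first exact: semi_boundedD.
  have -> : (diag_op (S1 \+ S2) (\0 : {linear H2 -> H2}) : HH -> HH) =
     fun x => diag_op S1 (\0 : {linear H2 -> H2}) x +
       diag_op S2 (\0 : {linear H2 -> H2}) x.
    by apply/funext => x; congr (_, _); rewrite /= addr0.
  by apply: T_add;
    do ?[exact/lift|apply: semi_bounded_diag => //; exact: semi_bounded0].
- by rewrite gt_eqF// (lt_le_trans M_gt0)// semi_opnorm_diag_ge1.
- move=> S1 S2 S1_sb S2_sb TS1 TS2.
  have compress (S : {linear HH -> HH}) : semi_bounded AA S ->
      semi_BJ_orthogonal AA T S <-> semi_BJ_orthogonal A1 M (compress1 S).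
    exact: BJ_orthogonal_diag.
  apply/(compress (S1 \+ S2)); first exact: semi_boundedD.
  by apply: (M_add (compress1 S1) (compress1 S2));
    do ?[exact/compress|exact: (semi_bounded_compress1 A1_pos A2_pos)].
Qed.

Lemma semi_opnorm_ge_block22 (S : {linear HH -> HH}) :
  semi_bounded AA S -> (forall v, (S (0, v)).2 = N v) ->
  semi_opnorm A2 N <= semi_opnorm AA S.
Proof.
move=> S_sb SN; apply: semi_opnorm_le => [|v]; first exact: semi_opnorm_ge0.
rewrite -SN -(semi_norm_inr A1_pos A2_pos v).
exact: le_trans (semi_norm_snd A1_pos A2_pos _) (semi_opnorm_ub _ S_sb).
Qed.

(** In the case of equality diag(M, 0) and diag(0, N) are both orthogonal to T,
    while their sum T is not, as the scalar -1 shows. *)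
Lemma semi_smooth_diag_neq :
  semi_smooth AA T -> semi_opnorm A1 M != semi_opnorm A2 N.
Proof.
move=> [_ T_neq0 T_add]; apply/negP => /eqP MN.
have T_le : semi_opnorm AA T <= semi_opnorm A1 M.
  by apply: semi_opnorm_diag_le => //; rewrite MN.
pose S1 : {linear HH -> HH} := diag_op M (\0 : {linear H2 -> H2}).
pose S2 : {linear HH -> HH} := diag_op (\0 : {linear H1 -> H1}) N.
have S1_sb : semi_bounded AA S1 by apply: semi_bounded_diag => //; exact: semi_bounded0.
have S2_sb : semi_bounded AA S2 by apply: semi_bounded_diag => //; exact: semi_bounded0.
have TS1 : semi_BJ_orthogonal AA T S1.
  move=> l; apply: le_trans T_le _; rewrite MN.
  apply: (semi_opnorm_ge_block22 (semi_boundedDZ AA_pos l T_sb S1_sb)) => v.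
  by rewrite /= scaler0 addr0.
have TS2 : semi_BJ_orthogonal AA T S2.
  move=> l; apply: le_trans T_le _.
  have := semi_opnorm_compress1 A1_pos A2_pos (semi_boundedDZ AA_pos l T_sb S2_sb).
  apply: le_trans; rewrite le_eqVlt; apply/orP; left; apply/eqP.
  by congr (semi_opnorm A1 _); apply/funext => u; rewrite /compress1 /= scaler0 addr0.
have := T_add S1 S2 S1_sb S2_sb TS1 TS2 (- 1); apply/negP; rewrite -ltNge.
rewrite (_ : (fun x => _) = fun=> 0); last first.
  apply/funext => x; rewrite scaleN1r; apply/eqP; rewrite subr_eq0; apply/eqP.
  by congr (_, _); rewrite /= ?addr0 ?add0r.
apply: (@le_lt_trans _ _ 0); last by rewrite lt_def T_neq0 semi_opnorm_ge0.
by apply: semi_opnorm_le => // x; rewrite semi_norm0 mul0r.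
Qed.

End Smoothness.

(** * Exchanging the two summands *)

Section Swap.
Context {R : realType} {k : scalar_kind} {H1 H2 : hilbertType R k}.

Definition swap (G1 G2 : hilbertType R k) (x : hsum G1 G2) : hsum G2 G1 := (x.2, x.1).

Fact swap_is_linear (G1 G2 : hilbertType R k) : linear (@swap G1 G2).
Proof. by []. Qed.

HB.instance Definition _ G1 G2 :=
  GRing.isLinear.Build (Defs.scalar R k) (hsum G1 G2) (hsum G2 G1) _
    (@swap G1 G2) (@swap_is_linear G1 G2).

Variables (A1 : {linear H1 -> H1}) (A2 : {linear H2 -> H2}).
Local Notation A12 := (diag_op A1 A2 : {linear hsum H1 H2 -> hsum H1 H2}).
Local Notation A21 := (diag_op A2 A1 : {linear hsum H2 H1 -> hsum H2 H1}).
Local Notation conj_swap S := (@swap _ _ \o S \o @swap _ _).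

Lemma semi_norm_swap (x : hsum H1 H2) : semi_norm A21 (swap x) = semi_norm A12 x.
Proof. by rewrite /semi_norm /semi_dotp !dotp_hsumE addrC. Qed.

Lemma semi_opnorm_swap (F : hsum H1 H2 -> hsum H1 H2) :
  semi_opnorm A21 (conj_swap F) = semi_opnorm A12 F.
Proof.
congr sup; apply/seteqP; split=> _ [x x1 <-].
  exists (swap x); last by rewrite /= semi_norm_swap.
  by move: x1; case: x => u v /= <-; rewrite -semi_norm_swap.
exists (swap x); rewrite /= ?semi_norm_swap//.
by case: x {x1}.
Qed.

Lemma semi_bounded_swap (S : {linear hsum H1 H2 -> hsum H1 H2}) :
  semi_bounded A12 S -> semi_bounded A21 (conj_swap S).
Proof.
have rnorm_swap (G1 G2 : hilbertType R k) (x : hsum G1 G2) : rnorm (swap x) = rnorm x.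
  by apply/eqP; rewrite -(@eqrXn2 _ 2) ?rnorm_ge0// !rnorm_hsum addrC.
move=> [/bounded_opP[b b0 Sb] [c c0 Sc]]; split.
  by apply/bounded_opP; exists b => // x; rewrite /= rnorm_swap -(rnorm_swap _ _ x).
exists c => // -[u v]; rewrite /= semi_norm_swap.
by rewrite -[(u, v)]/(swap ((v, u) : hsum H1 H2)) semi_norm_swap.
Qed.

End Swap.

(** Conjugation by the exchange of summands preserves operator seminorms and
    addition, and turns diag(M, N) into diag(N, M). *)
Lemma semi_smooth_swap {R : realType} {k : scalar_kind} {H1 H2 : hilbertType R k}
    (A1 M : {linear H1 -> H1}) (A2 N : {linear H2 -> H2}) :
  semi_smooth (diag_op A1 A2) (diag_op M N) ->
  semi_smooth (diag_op A2 A1) (diag_op N M).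
Proof.
move=> [T_sb T_neq0 T_add].
split.
- exact: (semi_bounded_swap T_sb).
- by move: T_neq0; rewrite -(semi_opnorm_swap A1 A2).
- have BJ_swap (S : hsum H2 H1 -> hsum H2 H1) :
      semi_BJ_orthogonal (diag_op A2 A1) (diag_op N M) S <->
      semi_BJ_orthogonal (diag_op A1 A2) (diag_op M N)
        (@swap _ _ _ _ \o S \o @swap _ _ _ _).
    by split=> TS l; have := TS l; rewrite -2!(semi_opnorm_swap A2 A1).
  move=> S1 S2 S1_sb S2_sb /BJ_swap TS1 /BJ_swap TS2; apply/BJ_swap.
  exact: (T_add _ _ (semi_bounded_swap S1_sb) (semi_bounded_swap S2_sb) TS1 TS2).
Qed.

Theorem theorem2p20 (R : realType) (k : scalar_kind) (H : hilbertType R k)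
    (A M N : {linear H -> H})
    (A_pos : positive_op A) (A_neq0 : exists x, A x != 0)
    (M_bounded : bounded_op M) (N_bounded : bounded_op N) :
  let AA : {linear hsum H H -> hsum H H} := diag_op A A in
  let T : {linear hsum H H -> hsum H H} := diag_op M N in
  semi_adjointable AA T ->
  semi_opnorm AA T != 0 ->
  [/\ semi_opnorm A N < semi_opnorm A M ->
        (semi_smooth AA T <-> semi_smooth A M),
      semi_opnorm A M < semi_opnorm A N ->
        (semi_smooth AA T <-> semi_smooth A N)
    & semi_opnorm A M = semi_opnorm A N -> ~ semi_smooth AA T].
Proof.
move=> AA T T_adj _.
have AA_pos : positive_op AA by exact: diag_op_positive.
have [M_sb N_sb] := semi_bounded_diagP A_pos A_pos M_bounded N_bounded
  (semi_adjointable_bounded AA_pos T_adj).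
split=> [NM|MN|MN_eq T_smooth].
- exact: semi_smooth_diag.
- apply: iff_trans (semi_smooth_diag A_pos A_pos N_sb M_sb MN).
  by split; exact: semi_smooth_swap.
- by have := semi_smooth_diag_neq A_pos A_pos M_sb N_sb T_smooth; rewrite MN_eq eqxx.
Qed.
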